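(* Every right-continuous Hausdorff Baire topology on the semigroup $\mathscr{C}_+(a,b)$ is discrete, and every left-continuous Hausdorff Baire topology on the semigroup $\mathscr{C}_-(a,b)$ is discrete.
   Context: $\omega$ denotes the set of non-negative integers. The bicyclic monoid $\mathscr{C}(a,b)$ is the semigroup with identity $1$ generated by two elements $a$ and $b$ subject only to the condition $ab=1$. Its elements are written uniquely as $b^ka^l$ with $k,l\in\omega$, and the operation is $$b^ka^l\cdot b^ma^n=\begin{cases} b^{k-l+m}a^n, & l<m;\\ b^ka^n, & l=m;\\ b^ka^{l-m+n}, & l>m.\end{cases}$$ Its subsemigroups $\mathscr{C}_+(a,b)$ and $\mathscr{C}_-(a,b)$ are defined by $$\mathscr{C}_{+}(a,b)=\{b^ia^j\in\mathscr{C}(a,b)\colon i\leqslant j,\ i,j\in\omega\},\qquad \mathscr{C}_{-}(a,b)=\{b^ia^j\in\mathscr{C}(a,b)\colon i\geqslant j,\ i,j\in\omega\}.$$ A topology on a semigroup $S$ is right-continuous if for every $s\in S$ the map $S\to S$, $x\mapsto sx$ is continuous; it is left-continuous if for every $s\in S$ the map $S\to S$, $x\mapsto xs$ is continuous. A topological space $X$ is Baire if for each sequence $A_1,A_2,\ldots$ of dense open subsets of $X$ the intersection $\bigcap_{i=1}^\infty A_i$ is dense in $X$; a topology is Baire if the corresponding space is Baire. *)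

(* Defs.v *)
From HB Require Import structures.
From mathcomp Require Import all_boot.
From mathcomp Require Import zify.
From mathcomp Require Import boolp classical_sets functions.
From mathcomp Require Import topology.

Set Implicit Arguments.
Unset Strict Implicit.
Unset Printing Implicit Defensive.

Local Open Scope classical_set_scope.

Record topology (T : Type) := Topology {
  topology_open : set_system T;
  topologyT : topology_open setT;
  topologyI : setI_closed topology_open;
  topologyU : forall D : set_system T,
    D `<=` topology_open -> topology_open (\bigcup_(A in D) A)
}.

(* The empty set is open by [topologyU] applied to the empty family. *)

(* Alias of [T] carrying the topology [tau], so that the notions on
   [topologicalType] apply to an arbitrary topology on a fixed type. *)
Definition topologized (T : Type) (tau : topology T) : Type := T.

Section topologized.
Context (T : choiceType) (tau : topology T).

HB.instance Definition _ := Choice.copy (topologized tau) T.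

Let topologized_bigU (I : Type) (f : I -> set T) :
  (forall i, topology_open tau (f i)) -> topology_open tau (\bigcup_i f i).
Proof.
move=> tauf; rewrite -(bigcup_image setT f id).
by apply: topologyU => _ [i _ <-].
Qed.

HB.instance Definition _ := isOpenTopological.Build (topologized tau)
  (topologyT tau) (@topologyI _ tau) topologized_bigU.

Lemma open_topologizedE (A : set (topologized tau)) :
  open A = topology_open tau A.
Proof.
have unionE : A = \bigcup_(B in [set B | topology_open tau B /\ B `<=` A]) B ->
    topology_open tau A.
  by move=> ->; apply: topologyU => B [].
apply/propext; split=> [oA|tauA].
  apply: unionE; apply/seteqP; split=> [x Ax|x [B [_ BA] /BA//]].
  move: oA; rewrite openE => /(_ x Ax) [B [tauB Bx BA]].
  by exists B.
by rewrite openE => x Ax; exists A; split.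
Qed.

End topologized.

Definition baire_space (X : topologicalType) :=
  forall A : nat -> set X, (forall i, open (A i) /\ dense (A i)) ->
    dense (\bigcap_i A i).

Definition discrete_space (X : topologicalType) := forall A : set X, open A.

Section topologies_on_semigroups.
Context (S : semigroupType) (tau : topology S).

(* [right_continuous]: continuity in the right factor, i.e. of the left
   shifts; dually for [left_continuous]. *)
Definition right_continuous := forall s : S,
  continuous ((fun x : S => (s * x)%g) : topologized tau -> topologized tau).

Definition left_continuous := forall s : S,
  continuous ((fun x : S => (x * s)%g) : topologized tau -> topologized tau).

End topologies_on_semigroups.

(* [Bicyclic k l] is the element b^k a^l. *)
Record bicyclic := Bicyclic { bexp : nat; aexp : nat }.

Definition bicyclic_pair (x : bicyclic) := (bexp x, aexp x).
Definition pair_bicyclic (p : nat * nat) := Bicyclic p.1 p.2.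
Lemma bicyclic_pairK : cancel bicyclic_pair pair_bicyclic.
Proof. by case. Qed.

HB.instance Definition _ := Countable.copy bicyclic (can_type bicyclic_pairK).

(* The truncated subtractions are exact in the branches where they occur. *)
Definition bicyclic_mul (x y : bicyclic) : bicyclic :=
  let: Bicyclic k l := x in
  let: Bicyclic m n := y in
  if l < m then Bicyclic (k + m - l) n
  else if l == m then Bicyclic k n
  else Bicyclic k (l - m + n).

Lemma bicyclic_mulE k l m n :
  bicyclic_mul (Bicyclic k l) (Bicyclic m n) =
  Bicyclic (k + (m - l)) (n + (l - m)).
Proof.
by rewrite /=; case: ltngtP => lm; congr Bicyclic; lia.
Qed.

Lemma bicyclic_mulA : associative bicyclic_mul.
Proof.
by move=> [k l] [m n] [p q]; rewrite !bicyclic_mulE; congr Bicyclic; lia.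
Qed.

Lemma bicyclic_mul1g : left_id (Bicyclic 0 0) bicyclic_mul.
Proof.
by case=> m n; rewrite bicyclic_mulE; congr Bicyclic; lia.
Qed.

Lemma bicyclic_mulg1 : right_id (Bicyclic 0 0) bicyclic_mul.
Proof.
by case=> m n; rewrite bicyclic_mulE; congr Bicyclic; lia.
Qed.

HB.instance Definition _ := isSemigroup.Build bicyclic bicyclic_mulA.
HB.instance Definition _ :=
  Semigroup_isMonoid.Build bicyclic bicyclic_mul1g bicyclic_mulg1.

Definition bicyclic_a : bicyclic := Bicyclic 0 1.
Definition bicyclic_b : bicyclic := Bicyclic 1 0.

Lemma bicyclic_ab : (bicyclic_a * bicyclic_b = 1)%g.
Proof. by []. Qed.

Lemma bicyclic_normal_form k l :
  Bicyclic k l = (bicyclic_b ^+ k * bicyclic_a ^+ l)%g.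
Proof.
have -> : (bicyclic_b ^+ k)%g = Bicyclic k 0.
  elim: k => // k IH; rewrite expgS IH [LHS]bicyclic_mulE.
  by congr Bicyclic; lia.
have -> : (bicyclic_a ^+ l)%g = Bicyclic 0 l.
  elim: l => // l IH; rewrite expgS IH [LHS]bicyclic_mulE.
  by congr Bicyclic; lia.
by rewrite [RHS]bicyclic_mulE; congr Bicyclic; lia.
Qed.

Definition Cplus_pred : {pred bicyclic} := fun x => bexp x <= aexp x.
Definition Cminus_pred : {pred bicyclic} := fun x => bexp x >= aexp x.

Lemma Cplus_closed : monoid_closed Cplus_pred.
Proof.
split=> // -[k l] [m n]; rewrite !unfold_in /= => kl mn.
by rewrite [(_ * _)%g]bicyclic_mulE /Cplus_pred /= in kl mn *; lia.
Qed.

Lemma Cminus_closed : monoid_closed Cminus_pred.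
Proof.
split=> // -[k l] [m n]; rewrite !unfold_in /= => kl mn.
by rewrite [(_ * _)%g]bicyclic_mulE /Cminus_pred /= in kl mn *; lia.
Qed.

Record Cplus := CPlus { Cplus_val :> bicyclic; _ : Cplus_pred Cplus_val }.
HB.instance Definition _ := [isSub for Cplus_val].
HB.instance Definition _ := [Countable of Cplus by <:].
HB.instance Definition _ :=
  SubChoice_isSubMonoid.Build bicyclic Cplus_pred Cplus Cplus_closed.

Record Cminus := CMinus { Cminus_val :> bicyclic; _ : Cminus_pred Cminus_val }.
HB.instance Definition _ := [isSub for Cminus_val].
HB.instance Definition _ := [Countable of Cminus by <:].
HB.instance Definition _ :=
  SubChoice_isSubMonoid.Build bicyclic Cminus_pred Cminus Cminus_closed.

(* Main.v *)
(* A countable Hausdorff Baire space has a dense set of isolated points. In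
   C_+(a,b) the left shift by ba is continuous and fixes exactly the b^m a^n with
   m > 0, so the powers of a form an open set; as points are closed, a^N is
   isolated for arbitrarily large N. Now a^l b^m a^n = a^N for l := m + N - n, and
   only finitely many elements are mapped to a^N by the left shift by a^l: they
   form a finite open set containing b^m a^n, which is therefore isolated. The
   case of C_-(a,b) is dual. *)
Require Import Defs.
From mathcomp Require Import all_boot.
From mathcomp Require Import boolp classical_sets topology.
From mathcomp Require Import functions cardinality zify.

Set Implicit Arguments.
Unset Strict Implicit.
Unset Printing Implicit Defensive.

Local Open Scope classical_set_scope.

Lemma open_not_fixed (X : topologicalType) (f : X -> X) :
  hausdorff_space X -> continuous f -> open [set x | f x != x].
Proof.
rewrite open_hausdorff => hX /continuousP cf.
rewrite openE => x /= fx_neq; rewrite /interior nbhsE.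
have [[A B] /= [/set_mem Afx /set_mem Bx] [oA oB /eqP AB0]] := hX _ _ fx_neq.
(* [A] and [B] are disjoint neighbourhoods of [f x] and [x]; a fixed point in this set would lie in
   both. *)
exists (B `&` f @^-1` A); first by split=> //; apply: openI => //; apply: cf.
move=> y [By Afy] /=; apply/eqP => fy; rewrite /= fy in Afy.
by have : (A `&` B) y by []; rewrite AB0.
Qed.

Lemma open_finite_isolated (X : topologicalType) (A : set X) (x : X) :
  accessible_space X -> open A -> finite_set A -> A x -> open [set x].
Proof.
move=> /accessible_finite_set_closed finC oA finA Ax.
have -> : [set x] = A `&` ~` (A `\ x).
  apply/seteqP; split=> [_ ->|y [Ay nAxy]] /=; first by split=> // [[_ /(_ erefl)]].
  by apply: contrapT => yx; apply: nAxy.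
by apply: openI => //; exact/closed_openC/(finC _ (finite_setD _ finA)).
Qed.

(** The code [g] makes [X] countable, so all non-isolated points are discarded by countably many
    dense open sets. *)
Lemma countable_baire_isolated (X : topologicalType) (g : X -> nat) (U : set X) :
  injective g -> accessible_space X -> baire_space X -> open U -> U !=set0 ->
  exists2 x, U x & open [set x].
Proof.
move=> g_inj accX baireX oU U0; apply: contrapT => noiso.
pose A i := ~` [set x | g x = i /\ ~ open [set x]].
suff /baireX dA : forall i, open (A i) /\ dense (A i).
  have [x [Ux Ax]] := dA U U0 oU.
  by apply: noiso; exists x => //; apply: contrapT => nox; apply: (Ax (g x)) => /=.
move=> i; split.
  apply/closed_openC; apply: (accessible_finite_set_closed.1 accX).
  apply: (@sub_finite_set _ _ (g @^-1` [set i])) => [x []//|].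
  by apply: finite_preimage => // x y _ _ /g_inj.
(* A nonempty open set missing [A i] is the single point coded by [i], which would then be
   isolated. *)
move=> O [x Ox] oO; apply: contrapT => OA0.
have Oi y : O y -> g y = i /\ ~ open [set y].
  by move=> Oy; apply: contrapT => nAy; apply: OA0; exists y.
have [gx []] := Oi x Ox.
suff -> : [set x] = O by [].
apply/seteqP; split=> [_ ->//|y /Oi[gy _]].
by apply: g_inj; rewrite gx gy.
Qed.

(* Stated in coordinates to cover both semigroups: [u] and [v] are the exponents
   of b and a in C_+(a,b) (of a and b in C_-(a,b)), [f l] is the shift by a^l
   (by b^l) and [e] the shift by ba. *)
Lemma baire_shifts_discrete (X : topologicalType) (u v : X -> nat)
    (f : nat -> X -> X) (e : X -> X) :
  injective (fun x => (u x, v x)) ->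
  (forall l, continuous (f l)) -> continuous e ->
  (forall l x, u (f l x) = u x - l) ->
  (forall l x, v (f l x) = v x + (l - u x)) ->
  (forall x, (e x == x) = (0 < u x)) ->
  hausdorff_space X -> baire_space X -> discrete_space X.
Proof.
move=> uv_inj cf ce uf vf eP hX baireX.
have accX := hausdorff_accessible hX.
have fin_box m n : finite_set [set x | u x < m /\ v x < n].
  apply: (@sub_finite_set _ _ ((fun x => (u x, v x)) @^-1` (`I_m `*` `I_n))) => //.
  by apply: finite_preimage => [x y _ _ /uv_inj//|]; apply: finite_setX.
suff iso (x : X) : open [set x].
  move=> A; have -> : A = \bigcup_(x in A) [set x].
    by apply/seteqP; split=> [x Ax|x [_ Ay ->]//]; exists x.
  by apply: bigcup_open.
(* [U] is given by [u y = 0] and [v x <= v y]; the latter makes the subtraction in [l] below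
   exact. *)
pose U := [set y | e y != y] `&` ~` [set y | u y < 1 /\ v y < v x].
have oU : open U.
  apply: openI; first exact: open_not_fixed.
  by apply/closed_openC; apply: (accessible_finite_set_closed.1 accX).
have U0 : U !=set0.
  (* This shift brings [u] to 0 and keeps [v x]. *)
  exists (f (u x) x); split; rewrite /= ?eP uf ?vf; lia.
have g_inj : injective (fun x => pickle (u x, v x)).
  by move=> y z /(pcan_inj pickleK) /uv_inj.
have [y [/= ey vy] oy] := countable_baire_isolated g_inj accX baireX oU U0.
rewrite eP in ey.
pose l := u x + v y - v x.
apply: (@open_finite_isolated _ (f l @^-1` [set y])) => //.
- by move/continuousP: (cf l); apply.
(* As [u y = 0], [f l z = y] forces [u z <= l] and [v z <= v y]. *)
- apply: sub_finite_set (fin_box l.+1 (v y).+1) => z /= fz.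
  by have := uf l z; have := vf l z; rewrite fz; lia.
- by apply: uv_inj; rewrite uf vf /l; congr pair; lia.
Qed.

Theorem theorem2 :
  (forall tau : topology Cplus,
     right_continuous tau ->
     hausdorff_space (topologized tau) ->
     baire_space (topologized tau) ->
     discrete_space (topologized tau))
  /\
  (forall tau : topology Cminus,
     left_continuous tau ->
     hausdorff_space (topologized tau) ->
     baire_space (topologized tau) ->
     discrete_space (topologized tau)).
Proof.
split=> tau ctau.
- have aP l : Cplus_pred (Bicyclic 0 l) by [].
  have baP : Cplus_pred (Bicyclic 1 1) by [].
  have valM (s x : Cplus) : Cplus_val (s * x)%g = bicyclic_mul s x by [].
  apply: (@baire_shifts_discrete (topologized tau)
    (fun x : Cplus => bexp x) (fun x : Cplus => aexp x)
    (fun l (x : Cplus) => (CPlus (aP l) * x)%g)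
    (fun x : Cplus => (CPlus baP * x)%g)) => //.
  + by move=> [[k l] p] [[m n] q] /= [km ln]; apply: val_inj; rewrite /= km ln.
  + by move=> l [[m n] p]; rewrite valM bicyclic_mulE.
  + by move=> l [[m n] p]; rewrite valM bicyclic_mulE.
  (* With truncated subtraction the product is b^(1+(m-1)) a^(n+(1-m)), which is b^m a^n exactly
     when m > 0. *)
  + move=> [[m n] p]; rewrite -val_eqE [val _]valM bicyclic_mulE.
    by apply/eqP/idP => /= [[] |? ]; [|congr Bicyclic]; lia.
- have bP l : Cminus_pred (Bicyclic l 0) by [].
  have baP : Cminus_pred (Bicyclic 1 1) by [].
  have valM (x s : Cminus) : Cminus_val (x * s)%g = bicyclic_mul x s by [].
  apply: (@baire_shifts_discrete (topologized tau)
    (fun x : Cminus => aexp x) (fun x : Cminus => bexp x)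
    (fun l (x : Cminus) => (x * CMinus (bP l))%g)
    (fun x : Cminus => (x * CMinus baP)%g)) => //.
  + by move=> [[k l] p] [[m n] q] /= [km ln]; apply: val_inj; rewrite /= km ln.
  + by move=> l [[m n] p]; rewrite valM bicyclic_mulE.
  + by move=> l [[m n] p]; rewrite valM bicyclic_mulE.
  + move=> [[m n] p]; rewrite -val_eqE [val _]valM bicyclic_mulE.
    by apply/eqP/idP => /= [[] |? ]; [|congr Bicyclic]; lia.
Qed.
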